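(* Let $D\ge 1$ be an integer, let $U=\mathcal{T}_D$, let $L$ be the Pommaret relative involutive division on $U$, and let $G_U$ be the related Ufnarovsky-like graph. (a) Let $M\subseteq U$ and let $J=(M)$ be the semigroup ideal generated by $M$. Then $J=\bigcup_{l\in M}C_L(l,U)$ if and only if $M$ is Ufnarovsky-compliant. (b) Let $N\subseteq U$. Then $H:=\bigl(\bigcup_{l\in N}C_L(l,U)\bigr)\cup\{v\in\mathcal{T}:\deg(v)<D\}$ is an order ideal if and only if $N$ is Ufnarovsky-revenant.
   Context: $\mathcal{T}$ is the set (monoid) of all terms (monic monomials) $x_1^{\gamma_1}\cdots x_n^{\gamma_n}$ in the variables $x_1,\dots,x_n$, ordered $x_1<\dots<x_n$; $\mathcal{T}_D$ is the set of terms of degree $D$. For a term $u\ne1$, $\min(u)$ is the smallest variable dividing $u$. The semigroup ideal generated by a set $M$ of terms is $(M)=\{\tau m:\tau\in\mathcal{T},m\in M\}$. A subset of $\mathcal{T}$ is an order ideal if it contains every divisor of each of its elements. The Pommaret relative involutive division $L$ on $U=\mathcal{T}_D$ assigns to each $u\in U$ the set of multiplicative variables $M_L(u,U)=\{x_i : x_i\le\min(u)\}$ and the set of non-multiplicative variables $NM_L(u,U)=\{x_1,\dots,x_n\}\setminus M_L(u,U)$. Put $L(u,U)=\{x_1^{a_1}\cdots x_n^{a_n} : a_i\neq0\Rightarrow x_i\in M_L(u,U)\}$ and $C_L(u,U)=\{uw : w\in L(u,U)\}$ (the cone of $u$). The Ufnarovsky-like graph $G_U$ is the oriented graph with vertex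 set $U$ in which, for $s,t\in U$, there is an edge $t\to s$ if and only if there is $x_j\in NM_L(s,U)$ with $sx_j\in C_L(t,U)$. A subset $M\subseteq U$ is Ufnarovsky-compliant if for all $s,t\in U$ with an edge $t\to s$ in $G_U$, $s\in M$ implies $t\in M$. A subset $N\subseteq U$ is Ufnarovsky-revenant if for all $s,t\in U$ with an edge $t\to s$ in $G_U$, $t\in N$ implies $s\in N$. *)

(* Defs.v *)
From mathcomp Require Import all_boot all_classical.
From mathcomp Require Import mpoly.

Set Implicit Arguments.
Unset Strict Implicit.
Unset Printing Implicit Defensive.

Local Open Scope classical_set_scope.

(* A term x_1^{c_1} ... x_n^{c_n} is its exponent vector, an element of
   'X_{1..n}.  The product of terms is therefore the sum (_ + _)%MM,
   divisibility is the pointwise order (_ <= _)%MM, and the variable with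
   index i is U_(i)%MM.  Variables are ordered as their indices in 'I_n. *)

Section Terms.
Variable n : nat.
Implicit Types (u v s t w : 'X_{1..n}) (U M N : set 'X_{1..n}).

Definition terms_deg (D : nat) : set 'X_{1..n} := [set u | mdeg u = D].

(* None exactly when u = 1. *)
Definition min_var u : option 'I_n :=
  [pick i | (u i != 0%N) && [forall j : 'I_n, (u j != 0%N) ==> (i <= j)%N]].

Definition semigroup_ideal M : set 'X_{1..n} :=
  [set v | exists t m, M m /\ v = (t + m)%MM].

Definition order_ideal (H : set 'X_{1..n}) : Prop :=
  forall u v, H v -> (u <= v)%MM -> H u.

(* A division on a set U of terms is given by its sets of multiplicative
   variables, mult u for u in U; values of mult outside U are irrelevant. *)
Section Division.
Variable mult : 'X_{1..n} -> set 'I_n.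

Definition nonmult u : set 'I_n := ~` mult u.

Definition mult_terms u : set 'X_{1..n} :=
  [set w : 'X_{1..n} | forall i, w i <> 0%N -> mult u i].

Definition cone u : set 'X_{1..n} := [set (u + w)%MM | w in mult_terms u].

(* ufn_edge U t s is the edge t -> s. *)
Definition ufn_edge U t s : Prop :=
  [/\ U t, U s & exists2 j : 'I_n, nonmult s j & cone t (s + U_(j))%MM].

Definition ufn_compliant U M : Prop :=
  forall s t, ufn_edge U t s -> M s -> M t.

Definition ufn_revenant U N : Prop :=
  forall s t, ufn_edge U t s -> N t -> N s.

End Division.

Definition pommaret u : set 'I_n :=
  [set i : 'I_n | exists2 k, min_var u = Some k & (i <= k)%N].

End Terms.

Arguments terms_deg n D : clear implicits.

(* Main.v *)
Require Import Defs.
From mathcomp Require Import all_boot all_classical.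
From mathcomp Require Import mpoly.
From mathcomp Require Import zify.

Set Implicit Arguments.
Unset Strict Implicit.
Unset Printing Implicit Defensive.

Local Open Scope classical_set_scope.

(** Membership of [v] in the Pommaret cone of [u] can be read off the exponents:
    [u] divides [v], and the variables that [v] has in excess of [u] are at most
    every variable of [u] (lemma [pommaret_coneP]).

    Two distinct cones with vertices of the same degree are disjoint: if [v] is
    in both, then each vertex exceeds the other one at some variable, and
    each of these two variables would have to be at most the other one.  Hence,
    when the cones over [M] cover the ideal of [M], the head of an edge being in
    [M] forces its tail, the only vertex whose cone contains [s x_j], to be in
    [M].

    All edges that the converses need are exchanges [s x_j = t x_i] with
    [i < j] and [x_i] at or below the support of [t] (lemma [exchange_edge]).
    If [M] is compliant, the union of its cones is stable under multiplication
    by any variable [x_j]: if [x_j] is non-multiplicative for [u], then trading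
    the smallest variable of [u] for [x_j] gives a tail of an edge into [u], and
    the product lies in the cone of this tail.  If [N] is revenant and [v x_j]
    lies in the cone of [u], a term [v] of degree at least [D] can leave
    this cone only because [u] is divisible by [x_j] once more than [v]; trading this
    [x_j] for the largest excess variable of [v] gives a head of an edge from
    [u], whose cone contains [v]. Conversely, if the union of cones of [N] and
    all smaller terms is an order ideal, then for an edge from [t] in [N] to
    [s] it contains [s x_j], hence its divisor [s], and a term of degree [D]
    lies in the cone of a vertex of degree [D] only as that vertex. *)

(** * Terms and one-variable steps *)

Lemma mdeg_lt_coord {n} (u v : 'X_{1..n}) :
  (mdeg u <= mdeg v)%N -> u != v -> exists i, (u i < v i)%N.
Proof.
move=> le_uv neq_uv; apply/existsP; apply: contraT.
rewrite negb_exists => /forallP le_vu.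
have def_u : (u - v + v)%MM = u.
  by apply: submK; apply/mnm_lepP => i; rewrite leqNgt.
have /eqP : mdeg (u - v)%MM = 0%N by move: le_uv; rewrite -{1}def_u mdegD; lia.
by rewrite mdeg_eq0 => /eqP uv0; rewrite -def_u uv0 add0m eqxx in neq_uv.
Qed.

Lemma mnm_ind {n} (P : 'X_{1..n} -> Prop) :
  P 0%MM -> (forall w j, P w -> P (w + U_(j))%MM) -> forall w, P w.
Proof.
move=> P0 PS w; move: {2}(mdeg w) (erefl (mdeg w)) => d.
elim: d w => [|d IHd] w dw; first by move/eqP: dw; rewrite mdeg_eq0 => /eqP ->.
have [| |j] := @mdeg_lt_coord n 0%MM w; first by rewrite mdeg0.
  by rewrite eq_sym -mdeg_eq0 dw.
rewrite mnm0E lt0n -lep1mP => /submK def_w; rewrite -def_w.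
by apply/PS/IHd; move: dw; rewrite -{1}def_w mdegD mdeg1; lia.
Qed.

Lemma semigroup_ideal_sub {n} (M K : set 'X_{1..n}) :
  M `<=` K -> (forall v j, K v -> K (v + U_(j))%MM) ->
  semigroup_ideal M `<=` K.
Proof.
move=> MK KS _ [w [m [/MK Km ->]]]; rewrite addmC.
move: w; apply: mnm_ind => [|w j IHw]; first by rewrite addm0.
by rewrite addmA; apply: KS.
Qed.

Lemma order_ideal_step {n} (H : set 'X_{1..n}) :
  (forall v j, H (v + U_(j))%MM -> H v) -> order_ideal H.
Proof.
move=> HS u v Hv /submK def_v; rewrite -def_v addmC in Hv.
move: (v - u)%MM Hv; apply: mnm_ind => [|w j IHw]; first by rewrite addm0.
by rewrite addmA => /HS.
Qed.

(** * Pommaret cones *)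

Section Pommaret.
Variable n : nat.
Implicit Types (u v s t : 'X_{1..n}) (i j k : 'I_n).

Lemma min_var_exists u : u != 0%MM ->
  exists2 i, u i != 0%N & forall k, u k != 0%N -> (i <= k)%N.
Proof.
move=> u_neq0; have [||i0] := @mdeg_lt_coord n 0%MM u; first by rewrite mdeg0.
  by rewrite eq_sym.
rewrite mnm0E lt0n => ui0.
have [i ui imin] :=
  @arg_minnP _ i0 (fun k => u k != 0%N) (fun k : 'I_n => k : nat) ui0.
by exists i.
Qed.

Lemma pommaretP u i : u != 0%MM ->
  pommaret u i <-> forall k, u k != 0%N -> (i <= k)%N.
Proof.
move=> u_neq0; rewrite /pommaret /min_var /=.
case: pickP => [k /andP[uk /forallP kmin]|no_min].
  split=> [[_ [<-] le_ik] l ul|]; last by move/(_ k uk); exists k.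
  by apply: leq_trans le_ik _; apply: (implyP (kmin l)).
have [k uk kmin] := min_var_exists u_neq0.
have /negP[] := negbT (no_min k); rewrite uk /=.
by apply/forallP => l; apply/implyP/kmin.
Qed.

(** Eliminating the cofactor and the minimal variable of [u] turns every later
    question about cones into inequalities between exponents. *)
Lemma pommaret_coneP u v : u != 0%MM ->
  cone (@pommaret n) u v <->
  (u <= v)%MM /\ forall i k, (u i < v i)%N -> u k != 0%N -> (i <= k)%N.
Proof.
move=> u_neq0; split=> [[w Lw <-]|[le_uv exc]].
  split=> [|i k]; first exact: lem_addr.
  rewrite mnmDE => wi; apply: (pommaretP i u_neq0).1; apply: Lw; lia.
exists (v - u)%MM; last by rewrite addmC submK.
move=> i; rewrite mnmBE => vui; apply/(pommaretP i u_neq0) => k.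
by apply: exc; lia.
Qed.

Lemma cone_self u : cone (@pommaret n) u u.
Proof. by exists 0%MM; rewrite ?addm0 // => i; rewrite mnm0E. Qed.

Lemma cone_deg u v : cone (@pommaret n) u v -> (mdeg v <= mdeg u)%N -> u = v.
Proof.
case=> w _ <-; rewrite mdegD => le_wu; have /eqP : mdeg w = 0%N by lia.
by rewrite mdeg_eq0 => /eqP ->; rewrite addm0.
Qed.

(** If the vertices differ, each exceeds the other somewhere; the two variables
    involved bound each other, so they coincide, which is absurd. *)
Lemma cone_disjoint u t v : u != 0%MM -> mdeg u = mdeg t ->
  cone (@pommaret n) u v -> cone (@pommaret n) t v -> u = t.
Proof.
move=> u_neq0 deg_ut Cu Ct; apply/eqP; apply: contraT => neq_ut.
have t_neq0 : t != 0%MM by rewrite -mdeg_eq0 -deg_ut mdeg_eq0.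
have [/mnm_lepP le_uv exc_u] := (pommaret_coneP _ u_neq0).1 Cu.
have [/mnm_lepP le_tv exc_t] := (pommaret_coneP _ t_neq0).1 Ct.
have [||i lt_ut] := @mdeg_lt_coord n u t; rewrite ?deg_ut //.
have [||k lt_tu] := @mdeg_lt_coord n t u; rewrite ?deg_ut // 1?eq_sym //.
have le_ik : (i <= k)%N by apply: exc_u; have := le_tv i; lia.
have le_ki : (k <= i)%N by apply: exc_t; have := le_uv k; lia.
have eq_ik : i = k by apply: val_inj; apply/eqP; rewrite eqn_leq le_ik.
by rewrite eq_ik in lt_ut; lia.
Qed.

(** Since [i != j], the variable [x_i] divides [s], so [x_j] lies above the
    smallest variable of [s] and is non-multiplicative for it. *)
Lemma exchange_edge D s t i j : (0 < D)%N -> mdeg s = D ->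
  (s + U_(j) = t + U_(i))%MM -> (i < j)%N ->
  (forall k, t k != 0%N -> (i <= k)%N) ->
  ufn_edge (@pommaret n) (terms_deg n D) t s.
Proof.
move=> D_gt0 deg_s def_st lt_ij imin.
have deg_t : mdeg t = D.
  by have := congr1 mdeg def_st; rewrite !mdegD !mdeg1; lia.
have s_neq0 : s != 0%MM by rewrite -mdeg_eq0; lia.
have t_neq0 : t != 0%MM by rewrite -mdeg_eq0; lia.
split=> //; exists j.
  move/(pommaretP _ s_neq0)/(_ i); have /mnmP/(_ i) := def_st.
  rewrite !mnmDE !mnm1E eqxx; case: eqP => [eq_ji|_]; last by lia.
  by rewrite eq_ji ltnn in lt_ij.
rewrite def_st; exists U_(i)%MM => // k; rewrite mnm1E.
by case: eqP => // <- _; apply/(pommaretP _ t_neq0).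
Qed.

(** * Stability of unions of cones *)

(** With [x_i] the smallest variable of the vertex [u] and [x_j]
    non-multiplicative, the new vertex is [t = u x_j / x_i]: its support still
    lies at or above [x_i], so [x_i] and the old excess variables are
    multiplicative for it. *)
Lemma cones_mulU D (M : set 'X_{1..n}) v j : (0 < D)%N ->
  M `<=` terms_deg n D -> ufn_compliant (@pommaret n) (terms_deg n D) M ->
  (\bigcup_(l in M) cone (@pommaret n) l) v ->
  (\bigcup_(l in M) cone (@pommaret n) l) (v + U_(j))%MM.
Proof.
move=> D_gt0 MD Mcpl [u Mu Cuv]; have deg_u : mdeg u = D by exact: MD.
have u_neq0 : u != 0%MM by rewrite -mdeg_eq0; lia.
have [/mnm_lepP le_uv exc] := (pommaret_coneP _ u_neq0).1 Cuv.
have [i ui imin] := min_var_exists u_neq0.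
have [le_ji|lt_ij] := leqP j i.
  exists u => //; apply/(pommaret_coneP _ u_neq0); split.
    by apply/mnm_lepP => k; rewrite mnmDE; apply: leq_trans (leq_addr _ _).
  move=> k l; rewrite mnmDE mnm1E; case: (eqVneq j k) => [<- _ ul|_].
    exact: leq_trans le_ji (imin l ul).
  by rewrite addn0; apply: exc.
have def_u : (u - U_(i) + U_(i) = u)%MM by apply: submK; rewrite lep1mP.
pose t := (u - U_(i) + U_(j))%MM.
have def_t : (u + U_(j) = t + U_(i))%MM.
  by rewrite -[in LHS]def_u -!addmA (addmC U_(_)%MM).
have tE k : (u k + (j == k) = t k + (i == k))%N.
  by have /mnmP/(_ k) := def_t; rewrite !mnmDE !mnm1E.
have tmin k : t k != 0%N -> (i <= k)%N.
  have := tE k; case: (eqVneq j k) => [<- _ _|_]; first exact: ltnW.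
  by move=> tk tk0; apply: imin; lia.
have t_neq0 : t != 0%MM.
  by have := congr1 mdeg def_t; rewrite -mdeg_eq0 !mdegD !mdeg1; lia.
exists t; first exact: Mcpl (exchange_edge D_gt0 deg_u def_t lt_ij tmin) Mu.
apply/(pommaret_coneP _ t_neq0); split.
  apply/mnm_lepP => k; rewrite mnmDE mnm1E.
  by have := tE k; have := le_uv k; lia.
move=> k l; rewrite mnmDE mnm1E => lt_tv /tmin; apply: leq_trans.
have := tE k; case: (eqVneq i k) => [<- //|_] tk.
by apply: exc ui; lia.
Qed.

(** If [v] is not in the cone of [u], the vertex [u] has one [x_j] too many,
    and since [v] has at least the degree of [u] it has excess variables.
    With [x_i] the largest of them, the new vertex is
    [s = u x_i / x_j]; the maximality of [x_i] makes the remaining excess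
    variables multiplicative for [s], whose smallest variable is [x_i]. *)
Lemma cones_divU D (N : set 'X_{1..n}) v j : (0 < D)%N ->
  N `<=` terms_deg n D -> ufn_revenant (@pommaret n) (terms_deg n D) N ->
  (D <= mdeg v)%N ->
  (\bigcup_(l in N) cone (@pommaret n) l) (v + U_(j))%MM ->
  (\bigcup_(l in N) cone (@pommaret n) l) v.
Proof.
move=> D_gt0 ND Nrev le_Dv [u Nu Cuv]; have deg_u : mdeg u = D by exact: ND.
have u_neq0 : u != 0%MM by rewrite -mdeg_eq0; lia.
have [/mnm_lepP le_uv exc] := (pommaret_coneP _ u_neq0).1 Cuv.
have {}le_uv k : (u k <= v k + (j == k))%N.
  by have := le_uv k; rewrite mnmDE mnm1E.
have {}exc k l : (u k < v k + (j == k))%N -> u l != 0%N -> (k <= l)%N.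
  by have := exc k l; rewrite mnmDE mnm1E.
have [le_uvj|lt_vuj] := leqP (u j) (v j).
  exists u => //; apply/(pommaret_coneP _ u_neq0); split.
    apply/mnm_lepP => k; have := le_uv k.
    by case: (eqVneq j k) => [<-|_]; rewrite ?addn0.
  by move=> k l lt_uv; apply: exc; lia.
have uj : u j = (v j).+1 by have := le_uv j; rewrite eqxx; lia.
have [||i0 lt_uv0] := @mdeg_lt_coord n u v; first by rewrite deg_u.
  by apply: contraTneq lt_vuj => ->; rewrite ltnn.
have [i lt_uv imax] := @arg_maxnP _ i0 (fun k => (u k < v k)%N)
  (fun k : 'I_n => k : nat) lt_uv0.
have neq_ij : i != j by apply: contraTneq lt_uv => ->; rewrite uj; lia.
have imin l : u l != 0%N -> (i <= l)%N by apply: exc; lia.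
have lt_ij : (i < j)%N by rewrite ltn_neqAle neq_ij imin // uj.
have def_u : (u - U_(j) + U_(j) = u)%MM by apply: submK; rewrite lep1mP uj.
pose s := (u - U_(j) + U_(i))%MM.
have def_s : (s + U_(j) = u + U_(i))%MM.
  by rewrite -[in RHS]def_u -!addmA (addmC U_(_)%MM).
have sE k : (s k + (j == k) = u k + (i == k))%N.
  by have /mnmP/(_ k) := def_s; rewrite !mnmDE !mnm1E.
have deg_s : mdeg s = D.
  by have := congr1 mdeg def_s; rewrite !mdegD !mdeg1; lia.
have s_neq0 : s != 0%MM by rewrite -mdeg_eq0; lia.
exists s; first exact: Nrev (exchange_edge D_gt0 deg_s def_s lt_ij imin) Nu.
apply/(pommaret_coneP _ s_neq0); split.
  apply/mnm_lepP => k; have := sE k; have := le_uv k.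
  case: (eqVneq i k) => [<-|_]; last by lia.
  by rewrite (eq_sym j) (negbTE neq_ij); lia.
move=> k l lt_sv sl; have le_ki : (k <= i)%N.
  have [->//|neq_ik] := eqVneq i k; apply: imax; have := sE k.
  case: (eqVneq j k) => [eq_jk|_]; last by rewrite (negbTE neq_ik); lia.
  move: lt_sv; rewrite -eq_jk (negbTE neq_ij); have := sE j.
  by rewrite eqxx (negbTE neq_ij); lia.
apply: leq_trans le_ki _; have := sE l.
by case: (eqVneq i l) => [<-//|_] def_sl; apply: imin; lia.
Qed.

End Pommaret.

(** * Compliant and revenant sets *)

Theorem proposition43 (n D : nat) (hD : (1 <= D)%N) :
  (forall M : set 'X_{1..n}, M `<=` terms_deg n D ->
     (semigroup_ideal M = \bigcup_(l in M) cone (@pommaret n) l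
      <-> ufn_compliant (@pommaret n) (terms_deg n D) M)) /\
  (forall N : set 'X_{1..n}, N `<=` terms_deg n D ->
     (order_ideal ((\bigcup_(l in N) cone (@pommaret n) l)
                   `|` [set v : 'X_{1..n} | (mdeg v < D)%N])
      <-> ufn_revenant (@pommaret n) (terms_deg n D) N)).
Proof.
split=> [M MD|N ND]; split.
- move=> JE s t [tD sD [j _ Ct]] Ms.
  have : semigroup_ideal M (s + U_(j))%MM.
    by exists U_(j)%MM, s; rewrite addmC.
  rewrite JE => -[l Ml Cl]; have deg_l : mdeg l = D by exact: MD.
  have l_neq0 : l != 0%MM by rewrite -mdeg_eq0 deg_l; lia.
  by rewrite -(cone_disjoint l_neq0 _ Cl Ct) // deg_l tD.
- move=> Mcpl; apply/seteqP; split.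
    apply: semigroup_ideal_sub => [m Mm|v j]; last exact: cones_mulU hD MD Mcpl.
    by exists m => //; apply: cone_self.
  by move=> _ [m Mm [w _ <-]]; exists w, m; rewrite addmC.
- move=> Hord s t [tD sD [j _ Ct]] Nt.
  have [||[l Nl Cl]|] := Hord s (s + U_(j))%MM; first by left; exists t.
  + exact: lem_addr.
  + by rewrite -(cone_deg Cl) // sD (ND l Nl).
  + by rewrite /= sD ltnn.
move=> Nrev; apply: order_ideal_step => v j Hv.
have [lt_vD|le_Dv] := ltnP (mdeg v) D; first by right.
case: Hv => [Cv|/=]; first by left; apply: cones_divU Nrev le_Dv Cv.
by rewrite mdegD; lia.
Qed.
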